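(* Let $E\in M(B\otimes C)$ be a regular separability idempotent, $A=C\otimes B$ the associated algebra, and $\widehat A=B\diamond C$ its dual. The coproduct $\Delta$ on $B\diamond C$, defined by $$\langle aa',u\diamond v\rangle=\langle a\otimes a',\Delta(u\diamond v)\rangle\qquad (a,a'\in A,\ u\in B,\ v\in C),$$ is given by $$\Delta(u\diamond v)=\sum_{(u),(v)}(u_{(1)}\diamond v_{(1)})\otimes(u_{(2)}\diamond v_{(2)}),$$ where $$\sum_{(u)}u_{(1)}\otimes u_{(2)}=\Delta_B(u)=F_1(1\otimes u)\in B\otimes B,\qquad \sum_{(v)}v_{(1)}\otimes v_{(2)}=\Delta_C(v)=(v\otimes 1)F_2\in C\otimes C,$$ with $F_1=(\iota\otimes S_C)E$ and $F_2=(S_B\otimes\iota)E$.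
   Context: Algebras are over $\mathbb C$, not necessarily unital, with non-degenerate product and idempotent; $M(\cdot)$ denotes the multiplier algebra. Let $B,C$ be such algebras. A regular separability idempotent is an idempotent $E\in M(B\otimes C)$ such that: (i) $E(1\otimes c)$ and $(b\otimes 1)E$ lie in $B\otimes C$ for all $b\in B,c\in C$; (ii) $E$ is full: $B$ is the smallest subspace $V$ with $E(1\otimes c)\in V\otimes C$ for all $c$, and $C$ is the smallest subspace $W$ with $(b\otimes 1)E\in B\otimes W$ for all $b$; (iii) there are anti-isomorphisms $S_B:B\to C$ and $S_C:C\to B$ with $E(b\otimes 1)=E(1\otimes S_B(b))$ and $(1\otimes c)E=(S_C(c)\otimes 1)E$. There are unique linear functionals $\varphi_B$ on $B$, $\varphi_C$ on $C$ with $(\varphi_B\otimes\iota)(E(1\otimes c))=c$ and $(\iota\otimes\varphi_C)((b\otimes 1)E)=b$. Known facts: they are faithful; $\varphi_B(bb')=\varphi_B(b'\sigma_B(b))$ with $\sigma_B=(S_CS_B)^{-1}$; $\varphi_C(cc')=\varphi_C(c'\sigma_C(c))$ with $\sigma_C=S_BS_C$; $\varphi_C=\varphi_B\circ S_C$, $\varphi_B=\varphi_C\circ S_B$; $(S_B\otimes S_C)E=\zeta E$ ($\zeta$ the flip). The multipliers $F_1\in M(B\otimes B^{\mathrm{op}})$-type and $F_2$ are obtained by applying $S_C$, resp. $S_B$, to a leg of $E$; they satisfy $(u\otimes 1)F_1=F_1(1\otimes u)$ and $(v\otimes 1)F_2=F_2(1\otimes v)$; concretely $F_1(1\otimes u)=(u\otimes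 1)F_1=(\iota\otimes S_C)((u\otimes 1)E)\in B\otimes B$ and $(v\otimes 1)F_2=F_2(1\otimes v)=(S_B\otimes\iota)(E(1\otimes v))\in C\otimes C$. $A=C\otimes B$ is spanned by elements $cb=bc$ ($b\in B$, $c\in C$, commuting inside $M(A)$). For $u\in B,v\in C$, $u\diamond v$ denotes the linear functional on $A$ given by $\langle cb,u\diamond v\rangle=\varphi_B(bS_C(v))\,\varphi_C(S_B(u)c)$. The dual $\widehat A=B\diamond C$ is the span of these functionals (equal to $\{\varphi(\,\cdot\,a):a\in A\}$ with $\varphi(cb)=\varphi_C(c)\varphi_B(b)$), and $u\otimes v\mapsto u\diamond v$ is a linear isomorphism $B\otimes C\to\widehat A$. The pairing of $A\otimes A$ with $\widehat A\otimes\widehat A$ is the tensor product pairing. *)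

(* Defs.v *)
From HB Require Import structures.
From mathcomp Require Import all_boot all_order all_algebra.
From mathcomp Require Import sesquilinear generic_quotient.
From mathcomp Require Import boolp classical_sets functions reals.
From mathcomp Require Import complex.

Set Implicit Arguments.
Unset Strict Implicit.
Unset Printing Implicit Defensive.

Import GRing.Theory.
Local Open Scope ring_scope.
Local Open Scope quotient_scope.
Local Open Scope classical_set_scope.

Reserved Notation "V ⊗ W" (at level 40, left associativity).
Reserved Notation "x ·n y" (at level 40, left associativity).
Reserved Notation "m ·m n" (at level 40, left associativity).
Reserved Notation "A ^op" (format "A ^op").

Lemma bilinearI (K : fieldType) (U V Z : lmodType K) (f : U -> V -> Z) :
  (forall y k x x', f (k *: x + x') y = k *: f x y + f x' y) ->
  (forall x k y y', f x (k *: y + y') = k *: f x y + f x y') ->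
  bilinear_for *:%R *:%R f.
Proof. by move=> hl hr; split=> ? ? ? ?; [exact: hl|exact: hr]. Qed.

Section Tensor.
Variables (K : fieldType) (V W : lmodType K).
Implicit Types (s t : seq (V * W)) (k : K).

(* Finite formal sums of pairs, modulo the usual relations. *)
Inductive tens_eq : seq (V * W) -> seq (V * W) -> Prop :=
| te_refl s : tens_eq s s
| te_sym s t : tens_eq s t -> tens_eq t s
| te_trans s t u : tens_eq s t -> tens_eq t u -> tens_eq s u
| te_cat s s' t t' : tens_eq s s' -> tens_eq t t' ->
    tens_eq (s ++ t) (s' ++ t')
| te_catC s t : tens_eq (s ++ t) (t ++ s)
| te_addl x x' y : tens_eq [:: (x + x', y)] [:: (x, y); (x', y)]
| te_addr x y y' : tens_eq [:: (x, y + y')] [:: (x, y); (x, y')]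
| te_scale k x y : tens_eq [:: (k *: x, y)] [:: (x, k *: y)]
| te_zero y : tens_eq [:: (0, y)] [::].

Definition tens_eqb s t := `[< tens_eq s t >].

Lemma tens_eqb_refl : reflexive tens_eqb.
Proof. by move=> s; apply/asboolP/te_refl. Qed.
Lemma tens_eqb_sym : symmetric tens_eqb.
Proof.
by move=> s t; apply/idP/idP => /asboolP h; apply/asboolP; exact: te_sym.
Qed.
Lemma tens_eqb_trans : transitive tens_eqb.
Proof.
by move=> t s u /asboolP h /asboolP h'; apply/asboolP; exact: te_trans h h'.
Qed.

Definition tens_equiv := EquivRel tens_eqb tens_eqb_refl tens_eqb_sym
  tens_eqb_trans.

Definition tensor := {eq_quot tens_equiv}.
HB.instance Definition _ := Choice.on tensor.

Definition tclass s : tensor := \pi_tensor s.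

Lemma tclassP s t : tclass s = tclass t <-> tens_eq s t.
Proof.
split; first by move/eqmodP/asboolP.
by move=> h; apply/eqmodP/asboolP.
Qed.

Lemma tclass_repr (a : tensor) : tclass (repr a) = a.
Proof. exact: reprK. Qed.

Definition tadd (a b : tensor) := tclass (repr a ++ repr b).
Definition tscale k (a : tensor) :=
  tclass [seq (k *: p.1, p.2) | p <- repr a].

Lemma te_map k s t : tens_eq s t ->
  tens_eq [seq (k *: p.1, p.2) | p <- s] [seq (k *: p.1, p.2) | p <- t].
Proof.
elim=> {s t}.
- by move=> s; exact: te_refl.
- by move=> s t _ h; exact: te_sym.
- by move=> s t u _ h _ h'; exact: te_trans h h'.
- by move=> s s' t t' _ h _ h'; rewrite !map_cat; exact: te_cat.
- by move=> s t; rewrite !map_cat; exact: te_catC.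
- by move=> x x' y /=; rewrite scalerDr; exact: te_addl.
- by move=> x y y' /=; exact: te_addr.
- move=> l x y /=; rewrite scalerA mulrC -scalerA; exact: te_scale.
- by move=> y /=; rewrite scaler0; exact: te_zero.
Qed.

Lemma tclassD s t : tclass (s ++ t) = tadd (tclass s) (tclass t).
Proof.
by apply/tclassP/te_cat; apply/tclassP; rewrite tclass_repr.
Qed.

Lemma tclassZ k s :
  tscale k (tclass s) = tclass [seq (k *: p.1, p.2) | p <- s].
Proof. by apply/tclassP/te_map/tclassP; rewrite tclass_repr. Qed.

Lemma tens_ind0 (P : tensor -> Prop) : (forall s, P (tclass s)) ->
  forall a, P a.
Proof. by move=> h a; rewrite -(tclass_repr a). Qed.

Lemma taddA : associative tadd.
Proof.
elim/tens_ind0=> s; elim/tens_ind0=> t; elim/tens_ind0=> u.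
by rewrite -!tclassD catA.
Qed.
Lemma taddC : commutative tadd.
Proof.
elim/tens_ind0=> s; elim/tens_ind0=> t.
by rewrite -!tclassD; apply/tclassP/te_catC.
Qed.
Lemma tadd0 : left_id (tclass [::]) tadd.
Proof. by elim/tens_ind0=> s; rewrite -tclassD. Qed.
Lemma tscaleDl a : {morph tscale^~ a : k l / k + l >-> tadd k l}.
Proof.
move=> k l; elim/tens_ind0: a => s; rewrite !tclassZ -tclassD.
apply/tclassP; elim: s => [|p s ih] /=; first exact: te_refl.
rewrite scalerDl.
apply: (te_trans (te_cat (te_addl _ _ _) ih)) => /=.
rewrite -cat1s -[X in tens_eq _ X]cat1s.
apply: te_cat (te_refl _) _.
rewrite -cat1s -[X in tens_eq _ (_ ++ X)]cat1s !catA.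
by apply: te_cat (te_refl _); exact: te_catC.
Qed.
Lemma tscale0 a : tscale 0 a = tclass [::].
Proof.
elim/tens_ind0: a => s; rewrite tclassZ; apply/tclassP.
elim: s => [|p s ih] /=; first exact: te_refl.
by rewrite scale0r; apply: (te_cat (te_zero _) ih).
Qed.
Lemma tscale1 : left_id 1 tscale.
Proof.
elim/tens_ind0=> s; rewrite tclassZ; congr tclass.
by elim: s => //= -[x y] s ->; rewrite scale1r.
Qed.
Lemma taddN : left_inverse (tclass [::]) (tscale (-1)) tadd.
Proof.
move=> a; rewrite -{2}(tscale1 a) -tscaleDl addNr; exact: tscale0.
Qed.

HB.instance Definition _ := GRing.isZmodule.Build tensor taddA taddC tadd0 taddN.

Lemma tscaleA k l a : tscale k (tscale l a) = tscale (k * l) a.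
Proof.
elim/tens_ind0: a => s; rewrite !tclassZ -map_comp; congr tclass.
by apply: eq_map => p /=; rewrite scalerA.
Qed.
Lemma tscaleDr : right_distributive tscale +%R.
Proof.
move=> k; elim/tens_ind0=> s; elim/tens_ind0=> t.
by rewrite -[_ + _]tclassD !tclassZ -[RHS]tclassD map_cat.
Qed.

HB.instance Definition _ := GRing.Zmodule_isLmodule.Build K tensor
  tscaleA tscale1 tscaleDr tscaleDl.

Definition tens (x : V) (y : W) : tensor := tclass [:: (x, y)].

Lemma tens_bilinear : bilinear_for *:%R *:%R tens.
Proof.
have te_scaler k x y : k *: tens x y = tens x (k *: y).
  by rewrite -[LHS]/(tscale k _) tclassZ; apply/tclassP/te_scale.
apply: bilinearI => [y k x x'|x k y y'].
  transitivity (tens (k *: x) y + tens x' y).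
    rewrite -[RHS]tclassD; apply/tclassP; exact: te_addl.
  by congr (_ + _); rewrite -[RHS]/(tscale k _) tclassZ.
transitivity (tens x (k *: y) + tens x y').
  rewrite -[RHS]tclassD; apply/tclassP; exact: te_addr.
by congr (_ + _); rewrite -te_scaler.
Qed.

HB.instance Definition _ :=
  bilinear_isBilinear.Build K V W tensor *:%R *:%R tens tens_bilinear.

Lemma tens_ind (P : tensor -> Prop) :
  P 0 -> (forall x y a, P a -> P (tens x y + a)) -> forall a, P a.
Proof.
move=> P0 PD; elim/tens_ind0; elim=> [//|[x y] s ih].
by rewrite -cat1s tclassD; exact: PD.
Qed.

End Tensor.

Arguments tens {K V W} x y.
Notation "V ⊗ W" := (tensor V W) : type_scope.
Notation "x ⊗ y" := (tens x y) : ring_scope.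

Section Lift.
Variables (K : fieldType) (V W Z : lmodType K) (f : {bilinear V -> W -> Z}).

(* The universal property: f factors through the tensor product. *)
Definition tlift (a : V ⊗ W) : Z := \sum_(p <- repr a) f p.1 p.2.

Lemma tens_eq_sum s t : tens_eq s t ->
  \sum_(p <- s) f p.1 p.2 = \sum_(p <- t) f p.1 p.2.
Proof.
elim=> {s t} //.
- by move=> s t u _ -> _ ->.
- by move=> s s' t t' _ h _ h'; rewrite !big_cat/= h h'.
- by move=> s t; rewrite !big_cat/= addrC.
- by move=> x x' y; rewrite !big_cons !big_nil/= linearDl addrA.
- by move=> x y y'; rewrite !big_cons !big_nil/= linearDr addrA.
- by move=> k x y; rewrite !big_cons !big_nil/= linearZl_LR linearZr_LR.
- by move=> y; rewrite !big_cons !big_nil/= linear0l addr0.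
Qed.

Lemma tlift_class s : tlift (tclass s) = \sum_(p <- s) f p.1 p.2.
Proof. by apply/tens_eq_sum/tclassP/tclass_repr. Qed.

Lemma tlift_linear : linear tlift.
Proof.
move=> k; elim/tens_ind0=> s; elim/tens_ind0=> t.
rewrite -[k *: _]/(tscale k _) tclassZ -[_ + _]tclassD !tlift_class big_cat/=.
congr (_ + _); rewrite big_map scaler_sumr; apply: eq_bigr => p _ /=.
by rewrite linearZl_LR.
Qed.
HB.instance Definition _ :=
  GRing.isLinear.Build K (V ⊗ W)%type Z *:%R tlift tlift_linear.

Lemma tliftE x y : tlift (x ⊗ y) = f x y.
Proof. by rewrite tlift_class big_seq1. Qed.

End Lift.

Lemma tens_ext (K : fieldType) (V W Z : lmodType K)
    (f g : {linear (V ⊗ W)%type -> Z}) :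
  (forall x y, f (x ⊗ y) = g (x ⊗ y)) -> f =1 g.
Proof.
move=> h; elim/tens_ind => [|x y a ih]; first by rewrite !linear0.
by rewrite !linearD h ih.
Qed.

Section TensorMap.
Variables (K : fieldType) (V W V' W' : lmodType K).
Variables (f : {linear V -> V'}) (g : {linear W -> W'}).

Definition tmap_pure (x : V) (y : W) : (V' ⊗ W')%type := f x ⊗ g y.
Lemma tmap_pure_bilinear : bilinear_for *:%R *:%R tmap_pure.
Proof.
apply: bilinearI => [y k x x'|x k y y']; rewrite /tmap_pure linearP.
  by rewrite linearDl linearZl_LR.
by rewrite linearDr linearZr_LR.
Qed.
HB.instance Definition _ :=
  bilinear_isBilinear.Build K V W (V' ⊗ W')%type *:%R *:%R tmap_pure
    tmap_pure_bilinear.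

Definition tmap : {linear (V ⊗ W)%type -> (V' ⊗ W')%type} := tlift tmap_pure.

Lemma tmapE x y : tmap (x ⊗ y) = f x ⊗ g y.
Proof. exact: tliftE. Qed.

End TensorMap.

(* The tensor product (U ⊗ U') x (V ⊗ V') -> Z ⊗ Z' of two bilinear maps. *)
Section TensorBilinear.
Variables (K : fieldType) (U V Z U' V' Z' : lmodType K).
Variables (f : {bilinear U -> V -> Z}) (g : {bilinear U' -> V' -> Z'}).

Definition tmap2_pure (x : U) (x' : U') : (V ⊗ V')%type -> (Z ⊗ Z')%type :=
  tmap (f x) (g x').

Lemma tmap2_pure_bilinear t :
  bilinear_for *:%R *:%R (fun x x' => tmap2_pure x x' t).
Proof.
apply: bilinearI => [x' k x y|x k x' y']; rewrite /tmap2_pure.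
  elim/tens_ind: t => [|v v' t ih].
    by rewrite !linear0 ?scaler0 addr0.
  rewrite !linearD ih !tmapE /= linearDl linearZl_LR linearDl linearZl_LR.
  by rewrite ?scalerDr addrACA.
elim/tens_ind: t => [|v v' t ih].
  by rewrite !linear0 ?scaler0 addr0.
rewrite !linearD ih !tmapE /= linearDl linearZl_LR linearDr linearZr_LR.
by rewrite ?scalerDr addrACA.
Qed.

Definition tmap2_slice t (x : U) (x' : U') := tmap2_pure x x' t.
HB.instance Definition _ t :=
  bilinear_isBilinear.Build K U U' (Z ⊗ Z')%type *:%R *:%R (tmap2_slice t)
    (tmap2_pure_bilinear t).

Definition tmap2 (s : (U ⊗ U')%type) (t : (V ⊗ V')%type) : (Z ⊗ Z')%type :=
  tlift (tmap2_slice t) s.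

Lemma tmap2_bilinear : bilinear_for *:%R *:%R tmap2.
Proof.
apply: bilinearI => [t k s s'|s k t t']; first exact: linearP.
elim/tens_ind: s => [|x x' s ih].
  by rewrite /tmap2 !linear0 ?scaler0 addr0.
have E w : tmap2 (x ⊗ x' + s) w = tmap (f x) (g x') w + tmap2 s w.
  by rewrite /tmap2 linearD /= tliftE.
by rewrite !E ih linearP scalerDr addrACA.
Qed.
HB.instance Definition _ :=
  bilinear_isBilinear.Build K (U ⊗ U')%type (V ⊗ V')%type (Z ⊗ Z')%type
    *:%R *:%R tmap2 tmap2_bilinear.

Lemma tmap2E x x' y y' : tmap2 (x ⊗ x') (y ⊗ y') = f x y ⊗ g x' y'.
Proof. by rewrite /tmap2 tliftE; exact: tmapE. Qed.

End TensorBilinear.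

Section Slices.
Variables (K : fieldType) (V W : lmodType K).

Definition lslice_pure (f : {linear V -> K^o}) (x : V) (y : W) : W := f x *: y.
Lemma lslice_pure_bilinear f : bilinear_for *:%R *:%R (lslice_pure f).
Proof.
apply: bilinearI => [y k x x'|x k y y']; rewrite /lslice_pure.
  by rewrite linearP scalerDl -scalerA.
by rewrite scalerDr !scalerA mulrC.
Qed.
HB.instance Definition _ f := bilinear_isBilinear.Build K V W W *:%R *:%R
  (lslice_pure f) (lslice_pure_bilinear f).

Definition rslice_pure (g : {linear W -> K^o}) (x : V) (y : W) : V := g y *: x.
Lemma rslice_pure_bilinear g : bilinear_for *:%R *:%R (rslice_pure g).
Proof.
apply: bilinearI => [y k x x'|x k y y']; rewrite /rslice_pure.
  by rewrite scalerDr !scalerA mulrC.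
by rewrite linearP scalerDl -scalerA.
Qed.
HB.instance Definition _ g := bilinear_isBilinear.Build K V W V *:%R *:%R
  (rslice_pure g) (rslice_pure_bilinear g).

(* f ⊗ ι and ι ⊗ g, with K ⊗ W = W and V ⊗ K = V. *)
Definition lslice f : {linear (V ⊗ W)%type -> W} := tlift (lslice_pure f).
Definition rslice g : {linear (V ⊗ W)%type -> V} := tlift (rslice_pure g).

Lemma lsliceE f x y : lslice f (x ⊗ y) = f x *: y.
Proof. exact: tliftE. Qed.
Lemma rsliceE g x y : rslice g (x ⊗ y) = g y *: x.
Proof. exact: tliftE. Qed.

End Slices.

Section Subspaces.
Variables (K : fieldType) (V : lmodType K).

Definition subspace (U : set V) : Prop :=
  U 0 /\ forall k x y, U x -> U y -> U (k *: x + y).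

Definition span (S : set V) : set V :=
  [set v | forall U, subspace U -> S `<=` U -> U v].

Lemma span_subspace S : subspace (span S).
Proof.
split=> [U [U0 _] _//|k x y hx hy U hU SU].
by apply: hU.2; [exact: hx|exact: hy].
Qed.

Lemma sub_span S : S `<=` span S.
Proof. by move=> x Sx U _; exact. Qed.

Definition span_pred (S : set V) : pred V := fun v => `[< span S v >].

Lemma span_pred_closed S : subsemimod_closed (span_pred S).
Proof.
have [h0 hP] := span_subspace S.
split; first split.
- exact/asboolP.
- move=> x y /asboolP hx /asboolP hy; apply/asboolP.
  by rewrite -[x]scale1r; exact: hP.
- move=> k x /asboolP hx; apply/asboolP.
  by rewrite -[_ *: _]addr0; exact: hP.
Qed.

Definition spanT (S : set V) : Type := {v : V | span_pred S v}.
HB.instance Definition _ S := SubChoice.on (spanT S).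
HB.instance Definition _ S := GRing.SubChoice_isSubLmodule.Build K V
  (span_pred S) (spanT S) (span_pred_closed S).

Definition in_span (S : set V) v (Sv : S v) : spanT S :=
  exist _ v (introT (asboolP _) (sub_span Sv)).

End Subspaces.

(* The image in V ⊗ W of X ⊗ Y, for subspaces X of V and Y of W. *)
Definition tens_sub (K : fieldType) (V W : lmodType K) (X : set V) (Y : set W)
  : set (V ⊗ W)%type := span [set x ⊗ y | x in X & y in Y].

HB.mixin Record Lmodule_isNuAlg (K : fieldType) A of GRing.Lmodule K A := {
  nmul : A -> A -> A;
  nmulA : associative nmul;
  nmul_bilinear : bilinear_for *:%R *:%R nmul
}.

#[short(type="nualgType")]
HB.structure Definition NuAlg (K : fieldType) :=
  {A of Lmodule_isNuAlg K A & GRing.Lmodule K A}.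

HB.instance Definition _ (K : fieldType) (A : nualgType K) :=
  bilinear_isBilinear.Build K A A A *:%R *:%R (@nmul K A) (@nmul_bilinear K A).

Notation "x ·n y" := (nmul x y) : ring_scope.

Definition nondegenerate_alg (K : fieldType) (A : nualgType K) : Prop :=
  (forall x : A, (forall y : A, x ·n y = 0) -> x = 0) /\
  (forall x : A, (forall y : A, y ·n x = 0) -> x = 0).

Definition idempotent_alg (K : fieldType) (A : nualgType K) : Prop :=
  span [set x ·n y | x in [set: A] & y in [set: A]] = setT.

Section Opposite.
Variables (K : fieldType) (A : nualgType K).

Definition opalg : Type := A.
HB.instance Definition _ := GRing.Lmodule.on opalg.

Definition opmul (x y : opalg) : opalg := (y : A) ·n (x : A).
Lemma opmulA : associative opmul.
Proof. by move=> x y z; rewrite /opmul nmulA. Qed.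
Lemma opmul_bilinear : bilinear_for *:%R *:%R opmul.
Proof. by split=> x k y z; rewrite /opmul; apply nmul_bilinear. Qed.
HB.instance Definition _ := Lmodule_isNuAlg.Build K opalg opmulA opmul_bilinear.
End Opposite.

Notation "A ^op" := (opalg A) : type_scope.

Section TensorAlg.
Variables (K : fieldType) (A B : nualgType K).

Definition tmul : (A ⊗ B)%type -> (A ⊗ B)%type -> (A ⊗ B)%type :=
  tmap2 nmul nmul.

Lemma tmulE x y x' y' : tmul (x ⊗ y) (x' ⊗ y') = (x ·n x') ⊗ (y ·n y').
Proof. exact: tmap2E. Qed.

Lemma tmul_bilinear : bilinear_for *:%R *:%R tmul.
Proof. exact: tmap2_bilinear. Qed.

Lemma tmulA : associative tmul.
Proof.
have Dl a b c : tmul (a + b) c = tmul a c + tmul b c by exact: linearDl.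
have Dr a b c : tmul a (b + c) = tmul a b + tmul a c by exact: linearDr.
have Zl a : tmul 0 a = 0 by exact: linear0l.
have Zr a : tmul a 0 = 0 by exact: linear0r.
elim/tens_ind=> [|x y a iha] b c; first by rewrite !Zl.
rewrite !Dl iha {iha}; congr (_ + _).
elim/tens_ind: b => [|x' y' b ihb]; first by rewrite Zr !Zl Zr.
rewrite Dr !Dl Dr ihb {ihb}; congr (_ + _).
elim/tens_ind: c => [|x'' y'' c ihc]; first by rewrite !Zr.
by rewrite !Dr ihc !tmulE !nmulA.
Qed.

HB.instance Definition _ :=
  Lmodule_isNuAlg.Build K (A ⊗ B)%type tmulA tmul_bilinear.

Lemma nmul_tensE (x x' : A) (y y' : B) :
  (x ⊗ y) ·n (x' ⊗ y') = (x ·n x') ⊗ (y ·n y').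
Proof. exact: tmulE. Qed.

End TensorAlg.

Record nuiso (K : fieldType) (A B : nualgType K) := NuIso {
  iso_fun :> {linear A -> B};
  iso_inv : B -> A;
  iso_funK : cancel iso_fun iso_inv;
  iso_invK : cancel iso_inv iso_fun;
  iso_funM : forall x y, iso_fun (x ·n y) = iso_fun x ·n iso_fun y
}.

Notation antiiso A B := (nuiso A B^op).

Section IsoInv.
Variables (K : fieldType) (A B : nualgType K) (f : nuiso A B).

Definition isoV (y : B) : A := iso_inv f y.
Lemma isoV_linear : linear isoV.
Proof.
move=> k x y; apply: (can_inj (iso_funK f)).
by rewrite /isoV linearP !iso_invK.
Qed.
HB.instance Definition _ := GRing.isLinear.Build K B A *:%R isoV isoV_linear.

Lemma isoK : cancel f isoV. Proof. exact: iso_funK. Qed.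
Lemma isoVK : cancel isoV f. Proof. exact: iso_invK. Qed.
Lemma isoVM x y : isoV (x ·n y) = isoV x ·n isoV y.
Proof. by apply: (can_inj isoK); rewrite iso_funM !isoVK. Qed.
End IsoInv.

Definition iso_id (K : fieldType) (A : nualgType K) : nuiso A A :=
  @NuIso K A A idfun id (fun=> erefl) (fun=> erefl) (fun _ _ => erefl).

Section TensorIso.
Variables (K : fieldType) (A B A' B' : nualgType K).
Variables (f : nuiso A A') (g : nuiso B B').

Lemma tens_isoK : cancel (tmap f g) (tmap (isoV f) (isoV g)).
Proof.
elim/tens_ind=> [|x y a ih]; first by rewrite !linear0.
by rewrite !linearD ih !tmapE /= !isoK.
Qed.
Lemma tens_isoVK : cancel (tmap (isoV f) (isoV g)) (tmap f g).
Proof.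
elim/tens_ind=> [|x y a ih]; first by rewrite !linear0.
by rewrite !linearD ih !tmapE /= !isoVK.
Qed.
Lemma tens_isoM a b : tmap f g (a ·n b) = tmap f g a ·n tmap f g b.
Proof.
elim/tens_ind: a => [|x y a iha].
  by rewrite !(linear0l, linear0).
rewrite !(linearDl, linearD) /= iha {iha}; congr (_ + _).
elim/tens_ind: b => [|x' y' b ihb].
  by rewrite !(linear0r, linear0).
rewrite !(linearDr, linearD) /= ihb {ihb}; congr (_ + _).
by rewrite !tmapE /= !nmul_tensE tmapE !iso_funM.
Qed.

Definition tens_iso : nuiso (A ⊗ B)%type (A' ⊗ B')%type :=
  NuIso tens_isoK tens_isoVK tens_isoM.

End TensorIso.

(* A double centralizer: [ml m x] is m x and [mr m x] is x m. *)
Record multiplier (K : fieldType) (A : nualgType K) := Multiplier {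
  ml : A -> A;
  mr : A -> A;
  ml_linear : linear ml;
  mr_linear : linear mr;
  mlM : forall x y, ml (x ·n y) = ml x ·n y;
  mrM : forall x y, mr (x ·n y) = x ·n mr y;
  mrl : forall x y, mr x ·n y = x ·n ml y
}.

Section MultiplierAlg.
Variables (K : fieldType) (A : nualgType K).
Implicit Types m n : multiplier A.

HB.instance Definition _ m := GRing.isLinear.Build K A A *:%R (ml m)
  (ml_linear m).
HB.instance Definition _ m := GRing.isLinear.Build K A A *:%R (mr m)
  (mr_linear m).

Lemma multP m n : ml m = ml n -> mr m = mr n -> m = n.
Proof.
case: m n => l r p1 p2 p3 p4 p5 [l' r' q1 q2 q3 q4 q5] /= el er.
rewrite -{}el -{}er in q1 q2 q3 q4 q5 *.
by congr Multiplier; exact: Prop_irrelevance.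
Qed.

Definition mone : multiplier A.
Proof. by exists idfun idfun. Defined.

Definition mmul m n : multiplier A.
Proof.
exists (ml m \o ml n) (mr n \o mr m).
- by move=> k x y /=; rewrite !linearP.
- by move=> k x y /=; rewrite !linearP.
- by move=> x y /=; rewrite !mlM.
- by move=> x y /=; rewrite !mrM.
- by move=> x y /=; rewrite !mrl.
Defined.

Definition inM (a : A) : multiplier A.
Proof.
exists (fun x => a ·n x) (fun x => x ·n a).
- by move=> k x y /=; rewrite linearDr linearZr_LR.
- by move=> k x y /=; rewrite linearDl linearZl_LR.
- by move=> x y /=; rewrite nmulA.
- by move=> x y /=; rewrite nmulA.
- by move=> x y /=; rewrite nmulA.
Defined.

(* The element of A equal to m (unique when A is non-degenerate); 0 if m is
   not in A. *)
Definition melt m : A := xget 0 [set a | inM a = m].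

End MultiplierAlg.

Notation "m ·m n" := (mmul m n) : ring_scope.

Section MultiplierTensor.
Variables (K : fieldType) (A B : nualgType K).

(* The inclusion of M(A) ⊗ M(B) in M(A ⊗ B), on simple tensors. *)
Definition mtens (m : multiplier A) (n : multiplier B) :
  multiplier (A ⊗ B)%type.
Proof.
exists (tmap (ml m) (ml n)) (tmap (mr m) (mr n)).
- exact: linearP.
- exact: linearP.
- move=> a b; elim/tens_ind: a => [|x y a iha].
    by rewrite !(linear0l, linear0).
  rewrite !(linearDl, linearD) /= iha {iha}; congr (_ + _).
  elim/tens_ind: b => [|x' y' b ihb].
    by rewrite !(linear0r, linear0).
  rewrite !(linearDr, linearD) /= ihb {ihb}; congr (_ + _).
  by rewrite !tmapE /= !nmul_tensE tmapE /= !mlM.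
- move=> a b; elim/tens_ind: a => [|x y a iha].
    by rewrite !(linear0l, linear0).
  rewrite !(linearDl, linearD) /= iha {iha}; congr (_ + _).
  elim/tens_ind: b => [|x' y' b ihb].
    by rewrite !(linear0r, linear0).
  rewrite !(linearDr, linearD) /= ihb {ihb}; congr (_ + _).
  by rewrite !tmapE /= !nmul_tensE tmapE /= !mrM.
- move=> a b; elim/tens_ind: a => [|x y a iha].
    by rewrite !(linear0l, linear0).
  rewrite !(linearDl, linearD) /= iha {iha}; congr (_ + _).
  elim/tens_ind: b => [|x' y' b ihb].
    by rewrite !(linear0r, linear0).
  rewrite !(linearDr, linearD) /= ihb {ihb}; congr (_ + _).
  by rewrite !tmapE /= !nmul_tensE /= !mrl.
Defined.

Definition leg1 (a : A) : multiplier (A ⊗ B)%type := mtens (inM a) (mone B).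
Definition leg2 (b : B) : multiplier (A ⊗ B)%type := mtens (mone A) (inM b).

End MultiplierTensor.

(* The extension of an isomorphism A -> B to the multiplier algebras. *)
Section MultiplierIso.
Variables (K : fieldType) (A B : nualgType K) (f : nuiso A B).

Definition miso (m : multiplier A) : multiplier B.
Proof.
exists (fun y => f (ml m (isoV f y))) (fun y => f (mr m (isoV f y))).
- by move=> k x y; rewrite !linearP.
- by move=> k x y; rewrite !linearP.
- by move=> x y; rewrite isoVM mlM iso_funM isoVK.
- by move=> x y; rewrite isoVM mrM iso_funM isoVK.
- by move=> x y; apply: (can_inj (isoVK f)); rewrite !isoVM !isoK mrl.
Defined.

End MultiplierIso.

Section Separability.
Variables (K : fieldType) (B C : nualgType K).

Record regular_separability_idempotent (E : multiplier (B ⊗ C)%type)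
    (SB : antiiso B C) (SC : antiiso C B) : Prop := RegularSepIdem {
  rsi_idem : E ·m E = E;
  rsi_inr : forall c : C, range (@inM K (B ⊗ C)%type) (E ·m leg2 B c);
  rsi_inl : forall b : B, range (@inM K (B ⊗ C)%type) (leg1 C b ·m E);
  rsi_fullB : forall V : set B, subspace V ->
    (forall c : C, (@inM K (B ⊗ C)%type @` tens_sub V setT) (E ·m leg2 B c)) ->
    V = setT;
  rsi_fullC : forall W : set C, subspace W ->
    (forall b : B, (@inM K (B ⊗ C)%type @` tens_sub setT W) (leg1 C b ·m E)) ->
    W = setT;
  rsi_SB : forall b : B, E ·m leg1 C b = E ·m leg2 B (SB b : C);
  rsi_SC : forall c : C, leg2 B c ·m E = leg1 C (SC c : B) ·m E
}.

(* (φ_B ⊗ ι)(E (1 ⊗ c)) = c. *)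
Definition left_functional (E : multiplier (B ⊗ C)%type)
    (phiB : {linear B -> K^o}) : Prop :=
  forall c : C, lslice C phiB (melt (E ·m leg2 B c)) = c.

(* (ι ⊗ φ_C)((b ⊗ 1) E) = b. *)
Definition right_functional (E : multiplier (B ⊗ C)%type)
    (phiC : {linear C -> K^o}) : Prop :=
  forall b : B, rslice B phiC (melt (leg1 C b ·m E)) = b.

Variables (E : multiplier (B ⊗ C)%type) (SB : antiiso B C) (SC : antiiso C B).

(* (ι ⊗ S_C) E and (S_B ⊗ ι) E.  S_C and S_B being anti-multiplicative, these
   are multipliers of B ⊗ B^op and C^op ⊗ C. *)
Definition F1 : multiplier (B ⊗ B^op)%type :=
  miso (tens_iso (iso_id B) SC) E.
Definition F2 : multiplier (C^op ⊗ C)%type :=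
  miso (tens_iso SB (iso_id C)) E.

(* F_1 (1 ⊗ u), where the product in the second leg is that of B: as a product
   of multipliers of B ⊗ B^op its factors are therefore exchanged. *)
Definition F1u (u : B) : multiplier (B ⊗ B^op)%type :=
  leg2 B (u : B^op) ·m F1.

(* (v ⊗ 1) F_2, where the product in the first leg is that of C. *)
Definition vF2 (v : C) : multiplier (C^op ⊗ C)%type :=
  F2 ·m leg1 C (v : C^op).

(* B ⊗ B^op and B ⊗ B are the same vector space. *)
Definition DeltaB (u : B) : (B ⊗ B)%type := melt (F1u u).
Definition DeltaC (v : C) : (C ⊗ C)%type := melt (vF2 v).

End Separability.

Section Dual.
Variables (K : fieldType) (B C : nualgType K).
Variables (SB : antiiso B C) (SC : antiiso C B).
Variables (phiB : {linear B -> K^o}) (phiC : {linear C -> K^o}).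

Local Notation A := (C ⊗ B)%type.

Definition diamond_pure (u : B) (v : C) (c : C) (b : B) : K^o :=
  phiB (b ·n (SC v : B)) * phiC ((SB u : C) ·n c).

Lemma diamond_pure_bilinear u v :
  bilinear_for *:%R *:%R (diamond_pure u v).
Proof.
apply: bilinearI => [b k c c'|c k b b']; rewrite /diamond_pure.
  by rewrite linearDr linearZr_LR linearP mulrDr; congr (_ + _); exact: mulrCA.
by rewrite linearDl linearZl_LR linearP mulrDl; congr (_ + _); rewrite -mulrA.
Qed.
HB.instance Definition _ u v := bilinear_isBilinear.Build K C B K^o *:%R *:%R
  (diamond_pure u v) (diamond_pure_bilinear u v).

Definition diamond_fun (u : B) (v : C) : A -> K^o := tlift (diamond_pure u v).

Lemma diamond_funE u v c b :
  diamond_fun u v (c ⊗ b) =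
  phiB (b ·n (SC v : B)) * phiC ((SB u : C) ·n c).
Proof. exact: tliftE. Qed.

Lemma diamond_fun_linear u v : linear (diamond_fun u v).
Proof. exact: linearP. Qed.

Definition diamonds : set (A -> K^o) :=
  [set diamond_fun u v | u in [set: B] & v in [set: C]].

(* The space B ⋄ C of functionals on A. *)
Definition dualA : Type := spanT diamonds.
HB.instance Definition _ := GRing.Lmodule.on dualA.

Definition diamond (u : B) (v : C) : dualA :=
  in_span (ex_intro2 _ _ u I (ex_intro2 _ _ v I erefl) :
    diamonds (diamond_fun u v)).

Lemma val_diamond u v : val (diamond u v) = diamond_fun u v.
Proof. by []. Qed.

Lemma diamond_bilinear : bilinear_for *:%R *:%R diamond.
Proof.
have ext (f g h : A -> K^o) k : linear f -> linear g -> linear h ->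
    (forall c b, f (c ⊗ b) = k *: g (c ⊗ b) + h (c ⊗ b)) -> f = k *: g + h.
  move=> lf lg lh e; apply/funext => a.
  change (f a = k *: g a + h a).
  pose L (q : A -> K^o) (lq : linear q) : {linear A -> K^o} :=
    HB.pack q (GRing.isLinear.Build K A K^o *:%R q lq).
  have z q : linear q -> q 0 = 0 := fun lq => linear0 (L q lq).
  have d q : linear q -> {morph q : x y / x + y} := fun lq => linearD (L q lq).
  elim/tens_ind: a => [|c b a ih]; first by rewrite !z // scaler0 addr0.
  by rewrite !d // ih e scalerDr addrACA.
apply: bilinearI => [v k u u'|u k v v']; apply: val_inj; rewrite linearP /=;
  apply: ext; try exact: diamond_fun_linear; move=> c b; rewrite !diamond_funE.
  rewrite linearP linearDl linearZl_LR linearP mulrDr; congr (_ + _).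
  exact: mulrCA.
rewrite linearP linearDr linearZr_LR linearP mulrDl; congr (_ + _).
by rewrite -mulrA.
Qed.
HB.instance Definition _ :=
  bilinear_isBilinear.Build K B C dualA *:%R *:%R diamond diamond_bilinear.

Definition pairing (a : A) (f : dualA) : K^o := val f a.

Lemma pairing_bilinear : bilinear_for *:%R *:%R pairing.
Proof.
apply: bilinearI => [f k a a'|a k f g]; last by rewrite /pairing linearP.
suff: linear (val f) by exact.
have /asboolP := valP f; apply; last first.
  by move=> _ [u _ [v _ <-]]; exact: diamond_fun_linear.
split=> [l x y|l p q hp hq m x y].
  by change ((0 : K^o) = l *: (0 : K^o) + 0); rewrite scaler0 addr0.
change (l *: p (m *: x + y) + q (m *: x + y) =
  m *: (l *: p x + q x) + (l *: p y + q y)).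
by rewrite hp hq !scalerDr !scalerA (mulrC l m) addrACA.
Qed.
HB.instance Definition _ :=
  bilinear_isBilinear.Build K A dualA K^o *:%R *:%R pairing pairing_bilinear.

(* The tensor product pairing of A ⊗ A with B ⋄ C ⊗ B ⋄ C. *)
Definition pairing2 (x : (A ⊗ A)%type) (w : (dualA ⊗ dualA)%type) : K^o :=
  lslice K^o idfun (tmap2 pairing pairing x w).

Lemma pairing2E a a' f g :
  pairing2 (a ⊗ a') (f ⊗ g) = pairing a f * pairing a' g.
Proof. by rewrite /pairing2 tmap2E; exact: tliftE. Qed.

Definition dual_coproduct (Delta : {linear dualA -> (dualA ⊗ dualA)%type}) :
    Prop :=
  forall (a a' : A) (u : B) (v : C),
    pairing (a ·n a') (diamond u v) = pairing2 (a ⊗ a') (Delta (diamond u v)).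

(* For p = Σ u_(1) ⊗ u_(2) and q = Σ v_(1) ⊗ v_(2), the element
   Σ (u_(1) ⋄ v_(1)) ⊗ (u_(2) ⋄ v_(2)). *)
Definition diamond2 (p : (B ⊗ B)%type) (q : (C ⊗ C)%type) :
    (dualA ⊗ dualA)%type :=
  tmap2 diamond diamond p q.

Lemma diamond2E u u' v v' :
  diamond2 (u ⊗ u') (v ⊗ v') = diamond u v ⊗ diamond u' v'.
Proof. exact: tmap2E. Qed.

End Dual.

Arguments dualA {K B C} SB SC phiB phiC.
Arguments diamond {K B C} SB SC phiB phiC u v.
Arguments diamond2 {K B C} SB SC phiB phiC p q.
Arguments dual_coproduct {K B C} SB SC phiB phiC Delta.

(* Main.v *)
(* Put E' = ζ (S_B ⊗ S_C) E.  The relations defining S_B and S_C, with the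
   normalization of φ_B and φ_C, give Σ S_B(x) y = c for E (1 ⊗ c) = Σ x ⊗ y and
   Σ x S_C(y) = b for (b ⊗ 1) E = Σ x ⊗ y; hence E' = E.  Together with
   (φ_B ⊗ ι)((b ⊗ 1) E) = S_C^-1(b) and (ι ⊗ φ_C)(E (1 ⊗ c)) = S_B^-1(c) this yields
     Σ φ_B(b S_C(v_1)) φ_B(b' S_C(v_2)) = φ_B(b b' S_C(v)),
     Σ φ_C(S_B(u_1) c) φ_C(S_B(u_2) c') = φ_C(S_B(u) c c'),
   whose product is the duality formula for u ⋄ v.  As elements of the dual are
   functions on A, the pairing separates the points of its tensor square; so the
   coproduct is unique, and it exists because it does on each u ⋄ v. *)
Require Import Defs.
From HB Require Import structures.
From mathcomp Require Import all_boot all_order all_algebra.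
From mathcomp Require Import sesquilinear.
From mathcomp Require Import boolp classical_sets functions reals complex.

Set Implicit Arguments.
Unset Strict Implicit.
Unset Printing Implicit Defensive.

Import GRing.Theory.
Local Open Scope ring_scope.
Local Open Scope classical_set_scope.

(** * Functionals separating the points of a vector space, by Zorn's lemma *)

Section LinearFunctionals.
Variables (K : fieldType) (V : lmodType K).

(* The functional is the coordinate along y modulo a subspace maximal among
   those avoiding y. *)
Lemma dual_separates (y : V) : y != 0 -> exists g : {linear V -> K^o}, g y != 0.
Proof.
move=> y0.
pose P (X : set V) :=
  (forall k v w, X v -> X w -> X (k *: v + w)) /\ ~ X y.
have [F FP Ftot|M [[Mlin My] Mmax]] := @Zorn_bigcup V P.
  split=> [k v w [X FX Xv] [Y FY Yw]|[X FX]]; last exact: (FP X FX).2.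
  have [XY|YX] := Ftot _ _ FX FY.
    by exists Y => //; apply: (FP Y FY).1 => //; exact: XY.
  by exists X => //; apply: (FP X FX).1 => //; exact: YX.
(* [P] does not ask for 0, so that the union of the empty chain satisfies it. Were M empty, the set
   of 0 alone would be a larger member. *)
have M0 : M 0.
  apply: contrapT => nM0.
  have Me v : ~ M v.
    by move=> Mv; apply: nM0; have := Mlin (-1) _ _ Mv Mv; rewrite scaleN1r addNr.
  apply: (Mmax [set 0]).
    by split=> [v /Me//|/(_ 0 erefl)].
  split=> [k v w -> ->|/= /eqP]; first by rewrite scaler0 addr0.
  exact/negP.
have MZ k v : M v -> M (k *: v) by move=> Mv; rewrite -[_ *: v]addr0; exact: Mlin.
have MD v w : M v -> M w -> M (v + w).
  by move=> Mv Mw; rewrite -[v]scale1r; exact: Mlin.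
have MN v w : M v -> M w -> M (v - w).
  by move=> Mv Mw; apply: MD => //; rewrite -scaleN1r; exact: MZ.
(* For v outside M, the space M + K v is strictly larger, so by maximality it contains y. Solving y
   = m + k v for v gives the coefficient k^-1. *)
have ex v : exists k, M (v - k *: y).
  have [Mv|nMv] := pselect (M v); first by exists 0; rewrite scale0r subr0.
  have : ~ P [set m + k *: v | m in M & k in [set: K]].
    apply: Mmax; split.
      by move=> m Mm; exists m => //; exists 0 => //; rewrite scale0r addr0.
    move/(_ v) => h; apply: nMv; apply: h.
    by exists 0 => //; exists 1 => //; rewrite add0r scale1r.
  move/not_andP => [h|/contrapT [m Mm [k _ e]]].
    exfalso; apply: h => k _ _ [m Mm [l _ <-]] [m' Mm' [l' _ <-]].
    exists (k *: m + m'); first exact: Mlin.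
    exists (k * l + l') => //.
    by rewrite scalerDl scalerDr -scalerA addrACA.
  have k0 : k != 0.
    by apply/eqP => k0; apply: My; rewrite -e k0 scale0r addr0.
  exists k^-1; rewrite -e scalerDr scalerA mulVf // scale1r opprD addrCA subrr.
  by rewrite addr0 -scaleN1r; apply/MZ/MZ.
have uniq v k l : M (v - k *: y) -> M (v - l *: y) -> k = l.
  move=> hk hl; apply/eqP; rewrite -subr_eq0; apply/negPn/negP => kl; apply: My.
  have := MZ (k - l)^-1 _ (MN _ _ hl hk).
  rewrite opprB [X in _ *: X]addrC addrA subrK -scalerBl.
  by rewrite scalerA mulVf // scale1r.
have [g gP] := choice ex.
have glin : linear (g : V -> K^o).
  move=> k v w; apply: (uniq (k *: v + w)) => //.
  have := Mlin k _ _ (gP v) (gP w).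
  by rewrite scalerBr scalerA addrACA -opprD -scalerDl.
pose L : {linear V -> K^o} :=
  HB.pack (g : V -> K^o) (GRing.isLinear.Build K V K^o *:%R g glin).
exists L; apply/eqP => /= gy0; apply: My.
by have := gP y; rewrite [g y]gy0 scale0r subr0.
Qed.

End LinearFunctionals.

(** * Separation of the points of a tensor product by slices *)

Section TensorSeparation.
Variables (K : fieldType) (V W : lmodType K).

(* Induction on the length of Σ x_i ⊗ y_i: if g y_0 <> 0, then slicing by g
   expresses x_0 through the other x_i, which removes one summand. *)
Lemma tens_slice_eq0 (G : set {linear W -> K^o}) :
  (forall y : W, (forall g, G g -> g y = 0) -> y = 0) ->
  forall z : (V ⊗ W)%type, (forall g, G g -> rslice V g z = 0) -> z = 0.
Proof.
move=> sepG; elim/tens_ind0 => s; move en : (size s) => n.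
elim: n s en => [|n ih] [//|[x y] s] //= [sn] hz.
have tcons p : tclass (p :: s) = p.1 ⊗ p.2 + tclass s.
  by rewrite -cat1s; case: p => ? ?; exact: tclassD.
have [y0|y0] := pselect (y = 0).
  rewrite tcons /= y0 linear0r add0r; apply: ih => // g Gg.
  by have := hz g Gg; rewrite tcons y0 /= linear0r add0r.
have [g Gg gy] : exists2 g, G g & g y != 0.
  apply: contrapT => h; apply: y0; apply: sepG => g Gg.
  by apply/eqP/negPn/negP => gy; apply: h; exists g.
pose k := (g y)^-1.
have rsl h t : rslice V h (tclass t) = \sum_(p <- t) h p.2 *: p.1.
  exact: tlift_class.
(* The vanishing slice by g gives x = - Σ k g(y_i) x_i. Substituting this in x ⊗ y moves the
   multiples of y into the second legs of the other summands. *)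
pose s' := [seq (p.1, p.2 - (k * g p.2) *: y) | p <- s].
have ex : x = - \sum_(p <- s) (k * g p.2) *: p.1.
  have := hz g Gg; rewrite rsl big_cons /= => /(congr1 (fun v => k *: v)).
  rewrite scaler0 scalerDr scalerA mulVf // scale1r scaler_sumr => /eqP.
  rewrite addr_eq0 => /eqP ->; congr (- _).
  by apply: eq_bigr => p _; rewrite scalerA.
have cls (t : seq (V * W)) : tclass t = \sum_(p <- t) p.1 ⊗ p.2.
  elim: t => [|[a b] t iht]; first by rewrite big_nil.
  by rewrite -cat1s tclassD big_cat big_seq1 -iht.
have e : tclass ((x, y) :: s) = tclass s'.
  rewrite tcons !cls /= big_map ex linearNl linear_sumlz.
  rewrite addrC -sumrB.
  apply: eq_bigr => p _ /=.
  by rewrite linearBr linearZr_LR linearZl_LR.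
rewrite e; apply: ih; first by rewrite size_map.
by move=> h Gh; rewrite -e; exact: hz.
Qed.

End TensorSeparation.

Section Distributivity.
Variables (K : fieldType) (A : nualgType K).
Implicit Types x y z : A.

Lemma nmulDl x y z : (x + y) ·n z = x ·n z + y ·n z.
Proof. exact: linearDl. Qed.
Lemma nmulDr x y z : x ·n (y + z) = x ·n y + x ·n z.
Proof. exact: linearDr. Qed.
Lemma nmulZl k x y : (k *: x) ·n y = k *: (x ·n y).
Proof. exact: linearZl_LR. Qed.
Lemma nmulZr k x y : x ·n (k *: y) = k *: (x ·n y).
Proof. exact: linearZr_LR. Qed.
Lemma nmul0l x : 0 ·n x = 0 :> A.
Proof. exact: linear0l. Qed.
Lemma nmul0r x : x ·n 0 = 0 :> A.
Proof. exact: linear0r. Qed.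

End Distributivity.

(** * Non-degeneracy of tensor products and opposite algebras *)

Section TensorNondegenerate.
Variables (K : fieldType) (B C : nualgType K).

(** The functionals y ↦ φ(y c) separate the points of C, since C is non-degenerate. Slicing z (b ⊗
    c) = 0 by φ says that the slice of z by such a functional is killed by every b, hence is 0. The
    other side is symmetric, with y ↦ φ(c y). *)
Lemma tens_nondegenerate : nondegenerate_alg B -> nondegenerate_alg C ->
  nondegenerate_alg (B ⊗ C)%type.
Proof.
move=> [lB rB] [lC rC]; split=> z hz.
- pose G : set {linear C -> K^o} :=
    [set g | exists (phi : {linear C -> K^o}) c, forall y, g y = phi (y ·n c)].
  apply: (@tens_slice_eq0 K B C G) => [y hy|g [phi [c gE]]].
    apply: lC => c; apply: contrapT => /eqP /dual_separates [phi /negP]; apply.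
    by apply/eqP; apply: (hy (phi \o mr (inM c))); exists phi, c.
  apply: lB => b; rewrite -(linear0 (rslice B phi)) -(hz (b ⊗ c)).
  elim/tens_ind: z {hz} => [|x y z ih]; first by rewrite !(linear0, linear0l).
  rewrite (linearD (rslice B g)) !linearDl linearD /= ih; congr (_ + _).
  by rewrite nmul_tensE !rsliceE gE linearZl_LR.
- pose G : set {linear C -> K^o} :=
    [set g | exists (phi : {linear C -> K^o}) c, forall y, g y = phi (c ·n y)].
  apply: (@tens_slice_eq0 K B C G) => [y hy|g [phi [c gE]]].
    apply: rC => c; apply: contrapT => /eqP /dual_separates [phi /negP]; apply.
    by apply/eqP; apply: (hy (phi \o ml (inM c))); exists phi, c.
  apply: rB => b; rewrite -(linear0 (rslice B phi)) -(hz (b ⊗ c)).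
  elim/tens_ind: z {hz} => [|x y z ih]; first by rewrite !(linear0, linear0r).
  rewrite (linearD (rslice B g)) !linearDr linearD /= ih; congr (_ + _).
  by rewrite nmul_tensE !rsliceE gE linearZr_LR.
Qed.

End TensorNondegenerate.

Lemma op_nondegenerate (K : fieldType) (A : nualgType K) :
  nondegenerate_alg A -> nondegenerate_alg (A^op)%type.
Proof. by move=> [l r]; split=> x hx; [apply: r|apply: l] => y; exact: hx. Qed.

(** * Elements of an algebra inside its multiplier algebra *)

Section MultiplierElement.
Variables (K : fieldType) (A : nualgType K).

Lemma nmul_injr : nondegenerate_alg A ->
  forall a a' : A, (forall z, a ·n z = a' ·n z) -> a = a'.
Proof.
move=> [l _] a a' h; apply/eqP; rewrite -subr_eq0; apply/eqP; apply: l => z.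
by rewrite linearBl /= h subrr.
Qed.

Lemma nmul_injl : nondegenerate_alg A ->
  forall a a' : A, (forall z, z ·n a = z ·n a') -> a = a'.
Proof.
move=> [_ r] a a' h; apply/eqP; rewrite -subr_eq0; apply/eqP; apply: r => z.
by rewrite linearBr /= h subrr.
Qed.

Lemma inMK (m : multiplier A) : range (@inM K A) m -> inM (melt m) = m.
Proof. by move=> [a _ e]; exact: (xgetI (P := [set a | inM a = m]) 0 e). Qed.

Lemma meltK : nondegenerate_alg A -> cancel (@inM K A) (@melt K A).
Proof.
move=> nd a; apply: nmul_injr => // z.
have e : inM (melt (inM a)) = inM a by apply: inMK; exists a.
by have := congr1 (fun m => ml m z) e.
Qed.

End MultiplierElement.

Section MultiplierAdditive.
Variables (K : fieldType) (A : nualgType K) (m : multiplier A).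

Lemma mlD : {morph ml m : x y / x + y}. Proof. exact: linearD. Qed.
Lemma mrD : {morph mr m : x y / x + y}. Proof. exact: linearD. Qed.
Lemma ml0 : ml m 0 = 0. Proof. exact: linear0. Qed.
Lemma mr0 : mr m 0 = 0. Proof. exact: linear0. Qed.

End MultiplierAdditive.

(** * The flip of a tensor product *)

Section Swap.
Variables (K : fieldType) (V W : lmodType K).

Definition tswap_pure (x : V) (y : W) : (W ⊗ V)%type := y ⊗ x.
Lemma tswap_pure_bilinear : bilinear_for *:%R *:%R tswap_pure.
Proof.
apply: bilinearI => [y k x x'|x k y y']; rewrite /tswap_pure.
  by rewrite linearDr linearZr_LR.
by rewrite linearDl linearZl_LR.
Qed.
HB.instance Definition _ := bilinear_isBilinear.Build K V W (W ⊗ V)%type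
  *:%R *:%R tswap_pure tswap_pure_bilinear.

Definition tswap : {linear (V ⊗ W)%type -> (W ⊗ V)%type} := tlift tswap_pure.

Lemma tswapE x y : tswap (x ⊗ y) = y ⊗ x.
Proof. exact: tliftE. Qed.

End Swap.
Arguments tswap {K V W}.

(* A^op and A share their underlying vector space. *)
Definition anti_linear (K : fieldType) (A A' : nualgType K) (S : antiiso A A') :
  {linear A -> A'} := iso_fun S.

(** * Multiplication by E and by the two legs on B ⊗ C *)

Section SeparabilityIdempotent.
Variables (K : fieldType) (B C : nualgType K).
Hypotheses (ndB : nondegenerate_alg B) (ndC : nondegenerate_alg C).
Variables (E : multiplier (B ⊗ C)%type) (SB : antiiso B C) (SC : antiiso C B).
Hypothesis E_rsi : regular_separability_idempotent E SB SC.
Variables (phiB : {linear B -> K^o}) (phiC : {linear C -> K^o}).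
Hypotheses (phiBP : left_functional E phiB) (phiCP : right_functional E phiC).

Let nd : nondegenerate_alg (B ⊗ C)%type := tens_nondegenerate ndB ndC.
Local Notation sb := (anti_linear SB).
Local Notation sc := (anti_linear SC).

Definition Er (c : C) : (B ⊗ C)%type := melt (E ·m leg2 B c).
Definition El (b : B) : (B ⊗ C)%type := melt (leg1 C b ·m E).

Implicit Types (b : B) (c : C) (z : (B ⊗ C)%type).
(** Left and right multiplication by b ⊗ 1 and by 1 ⊗ c. Right multiplications compose from the
    inside out: [R2 c (mr E z)] is z E (1 ⊗ c). *)
Local Notation L1 b := (ml (leg1 C b)).
Local Notation R1 b := (mr (leg1 C b)).
Local Notation L2 c := (ml (leg2 B c)).
Local Notation R2 c := (mr (leg2 B c)).

Let L1E b (x : B) (y : C) : L1 b (x ⊗ y) = (b ·n x) ⊗ y. Proof. exact: tmapE. Qed.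
Let R1E b (x : B) (y : C) : R1 b (x ⊗ y) = (x ·n b) ⊗ y. Proof. exact: tmapE. Qed.
Let L2E c (x : B) (y : C) : L2 c (x ⊗ y) = x ⊗ (c ·n y). Proof. exact: tmapE. Qed.
Let R2E c (x : B) (y : C) : R2 c (x ⊗ y) = x ⊗ (y ·n c). Proof. exact: tmapE. Qed.

Let sbM (x y : B) : sb (x ·n y) = sb y ·n sb x. Proof. exact (iso_funM SB x y). Qed.
Let scM (x y : C) : sc (x ·n y) = sc y ·n sc x. Proof. exact (iso_funM SC x y). Qed.

Lemma Er_mull c z : Er c ·n z = ml E (L2 c z).
Proof. by have /inMK/(congr1 (fun m => ml m z)) := rsi_inr E_rsi c. Qed.
Lemma Er_mulr c z : z ·n Er c = R2 c (mr E z).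
Proof. by have /inMK/(congr1 (fun m => mr m z)) := rsi_inr E_rsi c. Qed.
Lemma El_mull b z : El b ·n z = L1 b (ml E z).
Proof. by have /inMK/(congr1 (fun m => ml m z)) := rsi_inl E_rsi b. Qed.
Lemma El_mulr b z : z ·n El b = mr E (R1 b z).
Proof. by have /inMK/(congr1 (fun m => mr m z)) := rsi_inl E_rsi b. Qed.

Let mlE_SB b z : ml E (L1 b z) = ml E (L2 (sb b) z).
Proof. exact: (congr1 (fun m => ml m z) (rsi_SB E_rsi b)). Qed.
Let mrE_SB b z : R1 b (mr E z) = R2 (sb b) (mr E z).
Proof. exact: (congr1 (fun m => mr m z) (rsi_SB E_rsi b)). Qed.
Let mlE_SC c z : L2 c (ml E z) = L1 (sc c) (ml E z).
Proof. exact: (congr1 (fun m => ml m z) (rsi_SC E_rsi c)). Qed.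
Let mrE_SC c z : mr E (R2 c z) = mr E (R1 (sc c) z).
Proof. exact: (congr1 (fun m => mr m z) (rsi_SC E_rsi c)). Qed.
Let mlEE z : ml E (ml E z) = ml E z.
Proof. exact: (congr1 (fun m => ml m z) (rsi_idem E_rsi)). Qed.
Let mrEE z : mr E (mr E z) = mr E z.
Proof. exact: (congr1 (fun m => mr m z) (rsi_idem E_rsi)). Qed.

Let tens_mull (x : B) (y : C) z : (x ⊗ y) ·n z = L1 x (L2 y z).
Proof.
elim/tens_ind: z => [|x' y' z ih]; first by rewrite !(ml0, mr0) nmul0r.
by rewrite nmulDr ih !(mlD, mrD) nmul_tensE L2E L1E.
Qed.
Let tens_mulr (x : B) (y : C) z : z ·n (x ⊗ y) = R1 x (R2 y z).
Proof.
elim/tens_ind: z => [|x' y' z ih]; first by rewrite !(ml0, mr0) nmul0l.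
by rewrite nmulDl ih !(mlD, mrD) nmul_tensE R2E R1E.
Qed.
Let L1M b b' z : L1 b (L1 b' z) = L1 (b ·n b') z.
Proof.
elim/tens_ind: z => [|x' y' z ih]; first by rewrite !(ml0, mr0).
by rewrite !(mlD, mrD) ih !L1E nmulA.
Qed.
Let L2M c c' z : L2 c (L2 c' z) = L2 (c ·n c') z.
Proof.
elim/tens_ind: z => [|x' y' z ih]; first by rewrite !(ml0, mr0).
by rewrite !(mlD, mrD) ih !L2E nmulA.
Qed.
Let R1M b b' z : R1 b (R1 b' z) = R1 (b' ·n b) z.
Proof.
elim/tens_ind: z => [|x' y' z ih]; first by rewrite !(ml0, mr0).
by rewrite !(mlD, mrD) ih !R1E nmulA.
Qed.
Let R2M c c' z : R2 c (R2 c' z) = R2 (c' ·n c) z.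
Proof.
elim/tens_ind: z => [|x' y' z ih]; first by rewrite !(ml0, mr0).
by rewrite !(mlD, mrD) ih !R2E nmulA.
Qed.
Let R2D c c' z : R2 (c + c') z = R2 c z + R2 c' z.
Proof.
elim/tens_ind: z => [|x y z ih]; first by rewrite !mr0 addr0.
by rewrite !mrD ih !R2E nmulDr linearDr /= addrACA.
Qed.
Let R20 z : R2 0 z = 0.
Proof. by apply: (addrI (R2 0 z)); rewrite -R2D !addr0. Qed.
Let L1D b b' z : L1 (b + b') z = L1 b z + L1 b' z.
Proof.
elim/tens_ind: z => [|x y z ih]; first by rewrite !ml0 addr0.
by rewrite !mlD ih !L1E nmulDl linearDl /= addrACA.
Qed.
Let L10 z : L1 0 z = 0.
Proof. by apply: (addrI (L1 0 z)); rewrite -L1D !addr0. Qed.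
Let R12 b c z : R1 b (R2 c z) = R2 c (R1 b z).
Proof.
elim/tens_ind: z => [|x' y' z ih]; first by rewrite !(ml0, mr0).
by rewrite !(mlD, mrD) ih !R2E !R1E R2E.
Qed.

(** Right multiplication by b ⊗ c factors through that by 1 ⊗ c, so non-degeneracy needs to be
    tested on one leg only. *)
Let legr_inj (a a' : (B ⊗ C)%type) : (forall c, R2 c a = R2 c a') -> a = a'.
Proof.
move=> h; apply: (nmul_injr nd) => z.
elim/tens_ind: z => [|b c z ih]; first by rewrite !nmul0r.
by rewrite !nmulDr ih !tens_mulr h.
Qed.
Let legl_inj (a a' : (B ⊗ C)%type) : (forall b, L1 b a = L1 b a') -> a = a'.
Proof.
move=> h; apply: (nmul_injl nd) => z.
elim/tens_ind: z => [|b c z ih]; first by rewrite !nmul0l.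
have L12 w : L1 b (L2 c w) = L2 c (L1 b w).
  elim/tens_ind: w => [|x' y' w ih']; first by rewrite !(ml0, mr0).
  by rewrite !(mlD, mrD) ih' !L2E !L1E L2E.
by rewrite !nmulDl ih !tens_mull !L12 h.
Qed.

(** Since [melt] is a choice of preimage, linearity is tested on z E (1 ⊗ c), where c appears
    explicitly. *)
Lemma Er_linear : linear Er.
Proof.
move=> k c c'; apply: (nmul_injl nd) => z.
rewrite nmulDr nmulZr !Er_mulr.
elim/tens_ind: (mr E z) => [|x y w ih]; first by rewrite !(ml0, mr0) scaler0 addr0.
rewrite !(mlD, mrD) ih !R2E nmulDr nmulZr linearDr linearZr_LR /=.
by rewrite !scalerDr addrACA.
Qed.
HB.instance Definition _ := GRing.isLinear.Build K C (B ⊗ C)%type *:%R Er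
  Er_linear.

Lemma El_linear : linear El.
Proof.
move=> k b b'; apply: (nmul_injr nd) => z.
rewrite nmulDl nmulZl !El_mull.
elim/tens_ind: (ml E z) => [|x y w ih]; first by rewrite !(ml0, mr0) scaler0 addr0.
rewrite !(mlD, mrD) ih !L1E nmulDl nmulZl linearDl linearZl_LR /=.
by rewrite !scalerDr addrACA.
Qed.
HB.instance Definition _ := GRing.isLinear.Build K B (B ⊗ C)%type *:%R El
  El_linear.

(** * Normalization of E with respect to S_B and S_C *)

Lemma mlE_tens b c : ml E (b ⊗ c) = Er (sb b ·n c).
Proof.
apply: (nmul_injr nd) => z.
by rewrite -mlM tens_mull mlE_SB L2M -Er_mull.
Qed.

Lemma mrE_tens b c : mr E (b ⊗ c) = El (b ·n sc c).
Proof.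
apply: (nmul_injl nd) => z.
by rewrite -mrM tens_mulr R12 mrE_SC R1M -El_mulr.
Qed.

(** The maps x ⊗ y ↦ S_B(x) y and x ⊗ y ↦ x S_C(y). Moving one leg across E gives E z = E (1 ⊗
    [mulSB z]) and z E = ([mulSC z] ⊗ 1) E. *)
Definition mulSB (z : (B ⊗ C)%type) : C := tlift (@nmul K C) (tmap sb idfun z).
Definition mulSC (z : (B ⊗ C)%type) : B := tlift (@nmul K B) (tmap idfun sc z).

Lemma mulSB_tens (x : B) (y : C) : mulSB (x ⊗ y) = sb x ·n y.
Proof. by rewrite /mulSB tmapE tliftE. Qed.
Lemma mulSC_tens (x : B) (y : C) : mulSC (x ⊗ y) = x ·n sc y.
Proof. by rewrite /mulSC tmapE tliftE. Qed.
Let mulSBD (z w : (B ⊗ C)%type) : mulSB (z + w) = mulSB z + mulSB w.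
Proof. by rewrite /mulSB !linearD. Qed.
Let mulSCD (z w : (B ⊗ C)%type) : mulSC (z + w) = mulSC z + mulSC w.
Proof. by rewrite /mulSC !linearD. Qed.
Let mulSB0 : mulSB 0 = 0. Proof. by rewrite /mulSB !linear0. Qed.
Let mulSC0 : mulSC 0 = 0. Proof. by rewrite /mulSC !linear0. Qed.

(* E E = E forces E (1 ⊗ c) = E (1 ⊗ c') with c' = Σ S_B(x) y. *)
Lemma mulSB_Er c : mulSB (Er c) = c.
Proof.
have mlE z : ml E z = Er (mulSB z).
  elim/tens_ind: z => [|x y z ih]; first by rewrite mulSB0 !(ml0, mr0) !linear0.
  by rewrite mulSBD !(mlD, mrD) ih mlE_tens mulSB_tens linearD.
(* As φ_B ⊗ ι recovers c from [Er c], it is enough to compare both sides after [Er], where the claim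
   is E E (1 ⊗ c) = E (1 ⊗ c). *)
rewrite -[LHS]phiBP -[RHS]phiBP -/(Er _) -/(Er _) -mlE; congr (lslice _ _ _).
by apply: (nmul_injr nd) => z; rewrite -mlM Er_mull mlEE.
Qed.

Lemma mulSC_El b : mulSC (El b) = b.
Proof.
have mrE z : mr E z = El (mulSC z).
  elim/tens_ind: z => [|x y z ih]; first by rewrite mulSC0 !(ml0, mr0) !linear0.
  by rewrite mulSCD !(mlD, mrD) ih mrE_tens mulSC_tens linearD.
rewrite -[LHS]phiCP -[RHS]phiCP -/(El _) -/(El _) -mrE; congr (rslice _ _ _).
by apply: (nmul_injl nd) => z; rewrite -mrM El_mulr mrEE.
Qed.

(** Both sides are (b ⊗ 1) E (1 ⊗ c). *)
Lemma leg1_Er b c : L1 b (Er c) = R2 c (El b).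
Proof.
apply: (nmul_injr nd) => z.
by rewrite -mlM Er_mull -El_mull mrl.
Qed.

Lemma leg2_Er c c' : L2 c (Er c') = L1 (sc c) (Er c').
Proof. by apply: (nmul_injr nd) => z; rewrite -!mlM Er_mull mlE_SC. Qed.

Lemma leg1_El b b' : R1 b (El b') = R2 (sb b) (El b').
Proof. by apply: (nmul_injl nd) => z; rewrite -!mrM El_mulr mrE_SB. Qed.

(** * Invariance of E under ζ (S_B ⊗ S_C) *)

Definition flipS (z : (B ⊗ C)%type) : (B ⊗ C)%type := tswap (tmap sb sc z).

Lemma flipS_tens (x : B) (y : C) : flipS (x ⊗ y) = sc y ⊗ sb x.
Proof. by rewrite /flipS tmapE tswapE. Qed.
Let flipSD (z w : (B ⊗ C)%type) : flipS (z + w) = flipS z + flipS w.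
Proof. by rewrite /flipS !linearD. Qed.
Let flipS0 : flipS 0 = 0. Proof. by rewrite /flipS !linear0. Qed.

(* With E' = ζ (S_B ⊗ S_C) E, both E' E = E and E' E = E'. *)
Lemma flipS_Er c : flipS (Er c) = El (sc c).
Proof.
apply: legr_inj => c'.
have R z : mr E (flipS z) = El (sc (mulSB z)).
  elim/tens_ind: z => [|x y z ih].
    by rewrite flipS0 mulSB0 !(ml0, mr0) !linear0.
  rewrite flipSD mulSBD mrD ih flipS_tens mulSB_tens mrE_tens -scM.
  by rewrite !linearD.
(* E' inherits E' (b ⊗ 1) = E' (1 ⊗ S_B(b)): for b = S_C(d) this is the image of (1 ⊗ d) E = (S_C(d)
   ⊗ 1) E under the anti-multiplicative map [flipS]. *)
have S b : R1 b (flipS (Er c)) = R2 (sb b) (flipS (Er c)).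
  have [d <-] : exists d, sc d = b by exists (isoV SC b); exact (isoVK SC b).
  have e1 z : R1 (sc d) (flipS z) = flipS (L2 d z).
    elim/tens_ind: z => [|x y z ih]; first by rewrite flipS0 !(ml0, mr0) flipS0.
    by rewrite !(flipSD, mlD, mrD) ih L2E !flipS_tens R1E scM.
  have e2 z : R2 (sb (sc d)) (flipS z) = flipS (L1 (sc d) z).
    elim/tens_ind: z => [|x y z ih]; first by rewrite flipS0 !(ml0, mr0) flipS0.
    by rewrite !(flipSD, mlD, mrD) ih L1E !flipS_tens R2E sbM.
  by rewrite e1 e2 leg2_Er.
have T z : flipS (Er c) ·n z = R2 (mulSB z) (flipS (Er c)).
  elim/tens_ind: z => [|x y z ih]; first by rewrite nmul0r mulSB0 R20.
  by rewrite nmulDr ih mulSBD tens_mulr R12 S R2M mulSB_tens R2D.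
(* The product [flipS (Er c) ·n Er c'] is read twice: [T] lets the left factor absorb E, and [R]
   replaces E' by E. *)
by rewrite -[in LHS](mulSB_Er c') -T Er_mulr R mulSB_Er.
Qed.

(** The mirror argument: E E' equals E' by [T] and E by [R]. *)
Lemma flipS_El b : flipS (El b) = Er (sb b).
Proof.
apply: legl_inj => b'.
have R z : ml E (flipS z) = Er (sb (mulSC z)).
  elim/tens_ind: z => [|x y z ih].
    by rewrite flipS0 mulSC0 !(ml0, mr0) !linear0.
  rewrite flipSD mulSCD mlD ih flipS_tens mulSC_tens mlE_tens -sbM.
  by rewrite !linearD.
have S c : L2 c (flipS (El b)) = L1 (sc c) (flipS (El b)).
  have [d <-] : exists d, sb d = c by exists (isoV SB c); exact (isoVK SB c).
  have e1 z : L2 (sb d) (flipS z) = flipS (R1 d z).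
    elim/tens_ind: z => [|x y z ih]; first by rewrite flipS0 !(ml0, mr0) flipS0.
    by rewrite !(flipSD, mlD, mrD) ih R1E !flipS_tens L2E sbM.
  have e2 z : L1 (sc (sb d)) (flipS z) = flipS (R2 (sb d) z).
    elim/tens_ind: z => [|x y z ih]; first by rewrite flipS0 !(ml0, mr0) flipS0.
    by rewrite !(flipSD, mlD, mrD) ih R2E !flipS_tens L1E scM.
  by rewrite e1 e2 leg1_El.
have T z : z ·n flipS (El b) = L1 (mulSC z) (flipS (El b)).
  elim/tens_ind: z => [|x y z ih]; first by rewrite nmul0l mulSC0 L10.
  by rewrite nmulDl ih mulSCD tens_mull S L1M mulSC_tens L1D.
by rewrite -[in LHS](mulSC_El b') -T El_mull R mulSC_El.
Qed.

(** * Slices of E by φ_B and φ_C *)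

Lemma leg1_El_l b b' : L1 b (El b') = El (b ·n b').
Proof. by apply: (nmul_injr nd) => z; rewrite -mlM !El_mull L1M. Qed.

Lemma leg2_Er_r c c' : R2 c (Er c') = Er (c' ·n c).
Proof. by apply: (nmul_injl nd) => z; rewrite -mrM !Er_mulr R2M. Qed.

(** For b = S_C(d), one has (b ⊗ 1) E (1 ⊗ c) = (1 ⊗ d) E (1 ⊗ c), whose slice by φ_B is d c for
    every c. *)
Lemma lslice_El b : sc (lslice C phiB (El b)) = b.
Proof.
have [d <-] : exists d, sc d = b by exists (isoV SC b); exact (isoVK SC b).
congr (sc _); apply: (nmul_injr ndC) => c.
have lR2 z : lslice C phiB z ·n c = lslice C phiB (R2 c z).
  elim/tens_ind: z => [|x y z ih]; first by rewrite mr0 !linear0 nmul0l.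
  by rewrite mrD !linearD nmulDl -ih R2E !lsliceE nmulZl.
have lL2 z : lslice C phiB (L2 d z) = d ·n lslice C phiB z.
  elim/tens_ind: z => [|x y z ih]; first by rewrite ml0 !linear0 nmul0r.
  by rewrite mlD !linearD nmulDr ih L2E !lsliceE nmulZr.
by rewrite lR2 -leg1_Er -leg2_Er lL2 phiBP.
Qed.

(** For c = S_B(d), one has (b ⊗ 1) E (1 ⊗ c) = (b ⊗ 1) E (d ⊗ 1), whose slice by φ_C is b d for
    every b. *)
Lemma rslice_Er c : sb (rslice B phiC (Er c)) = c.
Proof.
have [d <-] : exists d, sb d = c by exists (isoV SB c); exact (isoVK SB c).
congr (sb _); apply: (nmul_injl ndB) => b.
have rL1 z : b ·n rslice B phiC z = rslice B phiC (L1 b z).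
  elim/tens_ind: z => [|x y z ih]; first by rewrite ml0 !linear0 nmul0r.
  by rewrite mlD !linearD nmulDr -ih L1E !rsliceE nmulZr.
have rR1 z : rslice B phiC (R1 d z) = rslice B phiC z ·n d.
  elim/tens_ind: z => [|x y z ih]; first by rewrite mr0 !linear0 nmul0l.
  by rewrite mrD !linearD nmulDl ih R1E !rsliceE nmulZl.
by rewrite rL1 leg1_Er -leg1_El rR1 phiCP.
Qed.

(** * The coproducts Δ_B and Δ_C and their slices *)

Lemma F1uE (u : B) : F1u E SC u = inM (tens_iso (iso_id B) SC (El u)).
Proof.
pose f := tens_iso (iso_id B) SC; rewrite -/f.
(* With u = S_C(d), F_1 (1 ⊗ u) is the image under ι ⊗ S_C of (1 ⊗ d) E, which equals (u ⊗ 1) E. *)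
have [d du] : exists d, sc d = u by exists (isoV SC u); exact (isoVK SC u).
have fl w : ml (leg2 B (u : B^op)) (f w) = f (L2 d w).
  elim/tens_ind: w => [|x y w ih]; first by rewrite ml0 !linear0.
  rewrite mlD !(linearD f) mlD ih L2E; congr (_ + _).
  by rewrite !tmapE /= iso_funM -du.
have fr w : mr (leg2 B (u : B^op)) (f w) = f (R2 d w).
  elim/tens_ind: w => [|x y w ih]; first by rewrite mr0 !linear0.
  rewrite mrD !(linearD f) mrD ih R2E; congr (_ + _).
  by rewrite !tmapE /= iso_funM -du.
have fMl a w : ml (inM (f a)) (f w) = f (a ·n w) by exact (esym (iso_funM f a w)).
have fMr a w : mr (inM (f a)) (f w) = f (w ·n a) by exact (esym (iso_funM f w a)).
apply: multP; apply/funext => z; rewrite -(isoVK f z).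
  by rewrite fMl El_mull -du -mlE_SC -fl du -[in RHS](isoK f (isoV f z)).
by rewrite fMr El_mulr -du -mrE_SC -[R2 d _](isoK f) -fr du.
Qed.

Lemma vF2E (v : C) : vF2 E SB v = inM (tens_iso SB (iso_id C) (Er v)).
Proof.
pose f := tens_iso SB (iso_id C); rewrite -/f.
(* With v = S_B(d), (v ⊗ 1) F_2 is the image under S_B ⊗ ι of E (d ⊗ 1), which equals E (1 ⊗ v). *)
have [d dv] : exists d, sb d = v by exists (isoV SB v); exact (isoVK SB v).
have fl w : ml (leg1 C (v : C^op)) (f w) = f (L1 d w).
  elim/tens_ind: w => [|x y w ih]; first by rewrite ml0 !linear0.
  rewrite mlD !(linearD f) mlD ih L1E; congr (_ + _).
  by rewrite !tmapE /= iso_funM -dv.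
have fr w : mr (leg1 C (v : C^op)) (f w) = f (R1 d w).
  elim/tens_ind: w => [|x y w ih]; first by rewrite mr0 !linear0.
  rewrite mrD !(linearD f) mrD ih R1E; congr (_ + _).
  by rewrite !tmapE /= iso_funM -dv.
have fMl a w : ml (inM (f a)) (f w) = f (a ·n w) by exact (esym (iso_funM f a w)).
have fMr a w : mr (inM (f a)) (f w) = f (w ·n a) by exact (esym (iso_funM f w a)).
apply: multP; apply/funext => z; rewrite -(isoVK f z).
  by rewrite fMl Er_mull -dv -mlE_SB -[L1 d _](isoK f) -fl dv.
by rewrite fMr Er_mulr -dv -mrE_SB -fr dv -[in RHS](isoK f (isoV f z)).
Qed.

Lemma DeltaBE (u : B) : DeltaB E SC u = tmap idfun sc (El u).
Proof.
rewrite /DeltaB F1uE.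
exact (meltK (tens_nondegenerate ndB (op_nondegenerate ndB)) _).
Qed.

Lemma DeltaCE (v : C) : DeltaC E SB v = tmap sb idfun (Er v).
Proof.
rewrite /DeltaC vF2E.
exact (meltK (tens_nondegenerate (op_nondegenerate ndC) ndC) _).
Qed.

(** The two factors of the pairing of c b with u ⋄ v, as functionals of u and of v. *)
Definition diamondC c : {linear B -> K^o} := phiC \o mr (inM c) \o sb.
Definition diamondB b : {linear C -> K^o} := phiB \o ml (inM b) \o sc.

(** In terms of (u ⊗ 1) E = Σ x ⊗ y, the left side involves S_B(x) and S_B(S_C(y)). Flip invariance
    turns Σ S_C(y) ⊗ S_B(x) into E (1 ⊗ S_B(u)); slicing E (1 ⊗ S_B(u) c) by φ_C and applying S_B
    then leaves S_B(u) c. *)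
Lemma slices_DeltaB c c' u :
  diamondC c (rslice B (diamondC c') (DeltaB E SC u)) = phiC (sb u ·n (c ·n c')).
Proof.
have S z : diamondC c (rslice B (diamondC c') (tmap idfun sc z)) =
    phiC (sb (rslice B phiC (R2 c (flipS z))) ·n c').
  elim/tens_ind: z => [|x y z ih].
    by rewrite flipS0 mr0 !linear0 nmul0l linear0.
  rewrite flipSD mrD !linearD nmulDl linearD -ih; congr (_ + _).
  rewrite flipS_tens R2E tmapE !rsliceE !linearZ nmulZl linearZ /=.
  exact: mulrC.
by rewrite DeltaBE S flipS_El leg2_Er_r rslice_Er nmulA.
Qed.

(** Symmetrically, flip invariance leads to (b' S_C(v) ⊗ 1) E, whose slice by φ_B is sent by S_C to
    b' S_C(v). *)
Lemma slices_DeltaC b b' v :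
  diamondB b (rslice C (diamondB b') (DeltaC E SB v)) = phiB ((b ·n b') ·n sc v).
Proof.
have S z : diamondB b (rslice C (diamondB b') (tmap sb idfun z)) =
    phiB (b ·n sc (lslice C phiB (L1 b' (flipS z)))).
  elim/tens_ind: z => [|x y z ih].
    by rewrite flipS0 ml0 !linear0 nmul0r linear0.
  rewrite flipSD mlD !linearD nmulDr linearD -ih; congr (_ + _).
  by rewrite flipS_tens L1E tmapE rsliceE lsliceE !linearZ nmulZr linearZ /=.
by rewrite DeltaCE S flipS_Er leg1_El_l lslice_El nmulA.
Qed.

(** * The pairing on tensor squares and the coproduct of the dual *)

Local Notation dual := (dualA SB SC phiB phiC).
Local Notation pairing2 := (@pairing2 K B C SB SC phiB phiC).

Lemma pairing2_linear (t : ((C ⊗ B) ⊗ (C ⊗ B))%type) : linear (pairing2 t).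
Proof. by move=> k w w'; rewrite /Defs.pairing2 linearPr linearP. Qed.

Lemma pairing2_linearl w : linear (fun t => pairing2 t w).
Proof. by move=> k t t'; rewrite /Defs.pairing2 linearPl linearP. Qed.

Let pairing2D t w w' : pairing2 t (w + w') = pairing2 t w + pairing2 t w'.
Proof. by have := pairing2_linear t 1 w w'; rewrite !scale1r. Qed.
Let pairing20 t : pairing2 t 0 = 0.
Proof. by apply: (addrI (pairing2 t 0)); rewrite -pairing2D !addr0. Qed.
Let pairing2Dl t t' w : pairing2 (t + t') w = pairing2 t w + pairing2 t' w.
Proof. by have := pairing2_linearl w 1 t t'; rewrite !scale1r. Qed.
Let pairing20l w : pairing2 0 w = 0.
Proof. by apply: (addrI (pairing2 0 w)); rewrite -pairing2Dl !addr0. Qed.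

(** Evaluations at the points a' separate the dual, so [tens_slice_eq0] applies to them. Each slice
    is again a function on A, with value at a the pairing with a ⊗ a'. *)
Lemma pairing2_inj (w w' : (dual ⊗ dual)%type) :
  (forall a a', pairing2 (a ⊗ a') w = pairing2 (a ⊗ a') w') -> w = w'.
Proof.
move=> h; apply/eqP; rewrite -subr_eq0; apply/eqP; set v := w - w'.
have hv a a' : pairing2 (a ⊗ a') v = 0.
  rewrite /v -scaleN1r addrC pairing2_linear h scaleN1r.
  exact: addNr.
have evP (a : (C ⊗ B)%type) : linear (pairing a : dual -> K^o).
  by move=> k f g; exact: linearPr.
pose ev (a : (C ⊗ B)%type) : {linear dual -> K^o} :=
  HB.pack (pairing a : dual -> K^o)
    (GRing.isLinear.Build K dual K^o *:%R _ (evP a)).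
apply: (tens_slice_eq0 (G := range ev)) => [f hf|_ [a' _ <-]].
  apply/val_inj/funext => a.
  by have := hf (ev a) (ex_intro2 _ _ a I erefl).
apply/val_inj/funext => a; rewrite -[RHS](hv a a').
elim/tens_ind: v {hv} => [|f g z ih]; first by rewrite pairing20 !linear0.
rewrite pairing2D pairing2E linearD [LHS]/= -ih rsliceE.
by congr (_ + _); exact: mulrC.
Qed.

(** Splits the duality formula into one identity for Δ_B and one for Δ_C. *)
Lemma pairing2_diamond2 b b' c c' p q :
  pairing2 ((c ⊗ b) ⊗ (c' ⊗ b')) (diamond2 SB SC phiB phiC p q) =
  diamondC c (rslice B (diamondC c') p) * diamondB b (rslice C (diamondB b') q).
Proof.
have dDl p1 p2 r : diamond2 SB SC phiB phiC (p1 + p2) r =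
    diamond2 SB SC phiB phiC p1 r + diamond2 SB SC phiB phiC p2 r.
  exact: linearDl.
have dDr r q1 q2 : diamond2 SB SC phiB phiC r (q1 + q2) =
    diamond2 SB SC phiB phiC r q1 + diamond2 SB SC phiB phiC r q2.
  exact: linearDr.
have d0l r : diamond2 SB SC phiB phiC 0 r = 0 by exact: linear0l.
have d0r r : diamond2 SB SC phiB phiC r 0 = 0 by exact: linear0r.
elim/tens_ind: p => [|u u' p ihp]; first by rewrite d0l pairing20 !linear0 mul0r.
rewrite dDl pairing2D ihp !linearD mulrDl; congr (_ + _).
elim/tens_ind: q {ihp} => [|v v' q ihq]; first by rewrite d0r pairing20 !linear0 mulr0.
rewrite dDr pairing2D ihq !linearD mulrDr; congr (_ + _).
rewrite diamond2E pairing2E !rsliceE !linearZ.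
rewrite /pairing !val_diamond !diamond_funE /=.
by rewrite mulrACA mulrC; congr (_ * _); exact: mulrC.
Qed.

Lemma pairing_mul_diamond a a' u v :
  pairing (a ·n a') (diamond SB SC phiB phiC u v) =
  pairing2 (a ⊗ a')
    (diamond2 SB SC phiB phiC (DeltaB E SC u) (DeltaC E SB v)).
Proof.
elim/tens_ind: a => [|c b a iha].
  by rewrite nmul0l !linear0l pairing20l.
rewrite nmulDl !linearDl /= pairing2Dl iha; congr (_ + _).
elim/tens_ind: a' {iha} => [|c' b' a' iha'].
  by rewrite nmul0r linear0l linear0r pairing20l.
rewrite nmulDr linearDl linearDr /= pairing2Dl iha'; congr (_ + _).
rewrite pairing2_diamond2 slices_DeltaB slices_DeltaC.
rewrite /pairing val_diamond nmul_tensE diamond_funE.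
exact: mulrC.
Qed.

Lemma dual_coproduct_exists : exists Delta, dual_coproduct SB SC phiB phiC Delta.
Proof.
have ex (f : dual) : exists w : (dual ⊗ dual)%type,
    forall a a', pairing (a ·n a') f = pairing2 (a ⊗ a') w.
  (* The functionals h for which h(a a') is given by pairing with some w form a subspace; it
     contains every u ⋄ v, hence their span. *)
  have /asboolP/(_ [set h : (C ⊗ B)%type -> K^o | exists w : (dual ⊗ dual)%type,
    forall a a', h (a ·n a') = pairing2 (a ⊗ a') w]) := valP f.
  apply; last first.
    move=> _ [u _ [v _ <-]]; exists (diamond2 SB SC phiB phiC (DeltaB E SC u)
      (DeltaC E SB v)) => a a'; exact: pairing_mul_diamond.
  split=> [|k h h' [w hw] [w' hw']]; first by exists 0 => a a'; rewrite pairing20.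
  by exists (k *: w + w') => a a'; rewrite pairing2_linear -hw -hw'.
have [D DP] := choice ex.
(* The chosen w is unique by [pairing2_inj], so the choice is linear. *)
have Dlin : linear D.
  move=> k f g; apply: pairing2_inj => a a'.
  by rewrite pairing2_linear -!DP linearPr.
pose L : {linear dual -> (dual ⊗ dual)%type} :=
  HB.pack D (GRing.isLinear.Build K dual (dual ⊗ dual)%type *:%R D Dlin).
by exists L => a a' u v; exact: DP.
Qed.

Lemma dual_coproductE Delta : dual_coproduct SB SC phiB phiC Delta ->
  forall u v, Delta (diamond SB SC phiB phiC u v) =
    diamond2 SB SC phiB phiC (DeltaB E SC u) (DeltaC E SB v).
Proof.
move=> DP u v; apply: pairing2_inj => a a'.
by rewrite -DP pairing_mul_diamond.
Qed.

End SeparabilityIdempotent.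

Theorem proposition3p7 (R : realType) (B C : nualgType R[i])
    (ndB : nondegenerate_alg B) (ndC : nondegenerate_alg C)
    (idB : idempotent_alg B) (idC : idempotent_alg C)
    (E : multiplier (B ⊗ C)%type) (SB : antiiso B C) (SC : antiiso C B)
    (E_rsi : regular_separability_idempotent E SB SC)
    (phiB : {linear B -> R[i]^o}) (phiC : {linear C -> R[i]^o})
    (phiBP : left_functional E phiB) (phiCP : right_functional E phiC) :
  [/\ forall u : B, range (@inM _ (B ⊗ B^op)%type) (F1u E SC u),
      forall v : C, range (@inM _ (C^op ⊗ C)%type) (vF2 E SB v),
      exists Delta, dual_coproduct SB SC phiB phiC Delta &
      forall Delta, dual_coproduct SB SC phiB phiC Delta ->
      forall (u : B) (v : C),
        Delta (diamond SB SC phiB phiC u v) =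
        diamond2 SB SC phiB phiC (DeltaB E SC u) (DeltaC E SB v)].
Proof.
split.
- by move=> u; rewrite (F1uE E_rsi); eexists.
- by move=> v; rewrite (vF2E E_rsi); eexists.
- exact: (dual_coproduct_exists ndB ndC E_rsi phiBP phiCP).
- exact: (dual_coproductE ndB ndC E_rsi phiBP phiCP).
Qed.
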